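(* Let $M\ge2$ be an integer and $\beta\in\big(1,\frac{1+\sqrt5}{2}\big)$. Then every $x\in\big(0,\frac{M}{\beta-1}\big)$ admits a $\beta$-expansion, i.e. a sequence $(a_i)\in\{0,\ldots,M\}^{\mathbb{N}}$ with $\sum_{i=1}^\infty\frac{a_i}{\beta^i}=x$, such that $\mathrm{freq}_k(a_i)$ does not exist for all $0\le k\le M$ (that is, for every $k\in\{0,\ldots,M\}$ the $k$-frequency of $(a_i)$ fails to exist).
   Context: For $(a_i)\in\{0,\ldots,M\}^{\mathbb{N}}$ and $k\in\{0,\ldots,M\}$, the $k$-frequency is $\mathrm{freq}_k(a_i)=\lim_{N\to\infty}\frac{\#\{1\le i\le N:a_i=k\}}{N}$; it is said not to exist when this limit does not exist. *)

(* Defs.v *)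
From mathcomp Require Import all_boot all_order all_algebra.
From mathcomp Require Import all_classical all_reals all_analysis.
Set Implicit Arguments.
Unset Strict Implicit.
Unset Printing Implicit Defensive.
Import Order.TTheory GRing.Theory Num.Theory.
Import numFieldNormedType.Exports.
Local Open Scope classical_set_scope.
Local Open Scope ring_scope.

(* A digit sequence (a_i)_(i >= 1) over {0, ..., M} is a function
   a : nat -> 'I_M.+1 with [a i] standing for a_(i+1). *)

Definition beta_expansion (R : realType) (M : nat) (beta : R)
    (a : nat -> 'I_M.+1) (x : R) : Prop :=
  series (fun i => (a i)%:R / beta ^+ i.+1 : R) @ \oo --> x.

Definition digit_count (M : nat) (a : nat -> 'I_M.+1) (k : 'I_M.+1)
    (N : nat) : nat :=
  #|[pred i : 'I_N | a i == k]|.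

Definition has_freq (R : realType) (M : nat) (a : nat -> 'I_M.+1)
    (k : 'I_M.+1) (l : R) : Prop :=
  (digit_count a k N)%:R / N%:R @[N --> \oo] --> l.

(* Main.v *)
Require Import Defs.
From mathcomp Require Import all_boot all_order all_algebra.
From mathcomp Require Import all_classical all_reals all_analysis.
From mathcomp Require Import ring lra.
Set Implicit Arguments.
Unset Strict Implicit.
Unset Printing Implicit Defensive.
Import Order.TTheory GRing.Theory Num.Theory.
Import numFieldNormedType.Exports.
Local Open Scope classical_set_scope.
Local Open Scope ring_scope.

(** Write h = 1/(beta - 1) and follow an expansion through its remainders
    r_0 = x, r_(n+1) = beta r_n - a_(n+1). A digit sequence expands x as soon as
    its remainders stay in (0, M h) (interior_digits_expansion), because the
    partial sums differ from x by r_n / beta^n. So the digits can be chosen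
    freely as long as the remainder does not leave that interval.

    Two digits a < b are enough to stay there for ever: once the remainder is in
    (a h, b h), the maps r -> beta r - a and r -> beta r - b act on that interval
    as s -> beta s and s -> beta s - 1 act on (0, h). Since beta < 2, the branch
    can be chosen so that s is eventually confined to [u - 1, u], with u the
    midpoint of [1, h]. There the telescoping identity
    d = s - s' + (beta - 1) s, for s' = beta s - d, shows that each of the two
    branches is taken with lower density at least (2 - beta)/2
    (balanced_from_core).

    Given any finite word already written and any digit k, one can therefore
    - continue with a pair of digits that avoids k for so long that k becomes
      arbitrarily rare in the whole word (extend_rare). Such a pair is (0, M)
      when 0 < k < M; it is (1, M) or (0, M - 1) when k is 0 or M, after the
      remainder has been moved into the corresponding interval
      (steer_avoiding). This is where M >= 2 is needed;
    - continue with a pair that contains k for so long that k makes up at least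
      (2 - beta)/4 of the whole word (extend_frequent).
    Alternating both kinds of extensions over all digits, each infinitely often,
    yields an expansion of x in which the proportion of every digit oscillates
    (oscillating_expansion). The bound on beta enters through beta < 2. *)

(** * Remainders *)

Definition remainder (R : realType) (beta : R) (w : seq nat) (r : R) : R :=
  foldl (fun r d => beta * r - d%:R) r w.

Lemma remainder_cat (R : realType) (beta : R) (v w : seq nat) (r : R) :
  remainder beta (v ++ w) r = remainder beta w (remainder beta v r).
Proof. exact: foldl_cat. Qed.

Lemma remainder_rcons (R : realType) (beta : R) (w : seq nat) (d : nat) (r : R) :
  remainder beta (rcons w d) r = beta * remainder beta w r - d%:R.
Proof. by rewrite -cats1 remainder_cat. Qed.

Lemma remainder_nseq (R : realType) (beta : R) (n d : nat) (r : R) :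
  beta != 1 ->
  remainder beta (nseq n d) r
    = d%:R / (beta - 1) + beta ^+ n * (r - d%:R / (beta - 1)).
Proof.
move=> b1; have b0 : beta - 1 != 0 by rewrite subr_eq0.
elim: n r => [|n IHn] r /=; first by rewrite expr0; ring.
by rewrite {}IHn exprS; field.
Qed.

(** The two maps attached to the digits a and b are conjugate, by the affine map
    sending (0, h) onto (a h, b h), to the maps of the binary digits 0 and 1. *)
Lemma remainder_pair (R : realType) (beta : R) (a b : nat) (v : seq bool)
    (s : R) : beta != 1 ->
  remainder beta [seq if c then b else a | c : bool <- v]
    (a%:R / (beta - 1) + (b%:R - a%:R) * s)
  = a%:R / (beta - 1)
    + (b%:R - a%:R) * remainder beta [seq nat_of_bool c | c <- v] s.
Proof.
move=> b1; have b0 : beta - 1 != 0 by rewrite subr_eq0.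
elim: v s => [//|c v IHv] s /=.
by rewrite -IHv; congr (remainder _ _ _); case: c => /=; field.
Qed.

(** Repeating a digit multiplies the distance to its fixed point by beta, so the
    first passage over a threshold overshoots it by a factor of at most beta. *)
Lemma expanding_orbit (R : realType) (beta t p : R) :
  1 < beta -> 0 < t <= p ->
  exists n, p < beta ^+ n * t <= beta * p.
Proof.
move=> b1 /andP[t0 tp].
have exn : exists n, p < beta ^+ n * t.
  have cv := @cvg_geometric R p beta^-1.
  have : `|beta^-1| < 1.
    by rewrite ger0_norm ?invr_ge0 ?invf_lt1//; lra.
  move=> /cv /cvgrPdist_lt /(_ t t0) [n _ /(_ n (leqnn n))] /=.
  rewrite sub0r normrN => /(le_lt_trans (ler_norm _)).
  rewrite /geometric /= exprVn ltr_pdivrMr; last by rewrite exprn_gt0 //; lra.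
  by rewrite mulrC; exists n.
have [[|n] lt_n min_n] := ex_minnP exn.
  by move: lt_n; rewrite expr0 mul1r; lra.
exists n.+1; rewrite lt_n /= exprS -mulrA ler_pM2l; last by lra.
by rewrite leNgt; apply/negP => /min_n; rewrite ltnn.
Qed.

(** * Two digits used in balanced proportions *)

(** Choosing digit 1 exactly when beta s > u keeps the remainder in [u - 1, u]:
    with digit 0 it does not decrease, with digit 1 it does not increase. For
    the counts, digit d sends s to s' = beta s - d, whence
    d = s - s' + (beta - 1) s and
    1 - d = s' - s + 1 - (beta - 1) s. As (beta - 1) s runs between
    (beta - 1) (u - 1) = (2 - beta)/2 and (beta - 1) u = beta/2, both right-hand
    sides telescope up to a gain of at least (2 - beta)/2 per digit. *)
Lemma balanced_from_core (R : realType) (beta : R) (n : nat) (s : R) :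
  let u := (1 + (beta - 1)^-1) / 2 in
  1 < beta < 2 -> u - 1 <= s <= u ->
  exists v : seq bool,
    let s' := remainder beta [seq nat_of_bool c | c <- v] s in
    [/\ size v = n, u - 1 <= s' <= u,
      (2 - beta) / 2 * n%:R + s - s' <= (count id v)%:R &
      (2 - beta) / 2 * n%:R + s' - s <= (count negb v)%:R].
Proof.
move=> u /andP[b1 b2]; set h := (beta - 1)^-1 in u *.
have bh : (beta - 1) * h = 1 by rewrite mulfV // subr_eq0; lra.
have bu : (beta - 1) * u = beta / 2.
  by rewrite /u mulrA mulrDr bh; congr (_ / _); ring.
have bu' : beta * u = beta / 2 + u by rewrite -bu; ring.
have h1 : 1 < h by rewrite invf_gt1; lra.
elim: n s => [|n IHn] s /andP[s1 s2].
  exists [::]; split => //=; rewrite /remainder /= ?s1 ?s2 //; lra.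
have m1 : (beta - 1) * (u - 1) <= (beta - 1) * s by rewrite ler_pM2l; lra.
have m2 : (beta - 1) * s <= (beta - 1) * u by rewrite ler_pM2l; lra.
have [lt_u|ge_u] := leP (beta * s) u.
- have [|v [sz inv cT cF]] := IHn (beta * s); first by lra.
  exists (false :: v); rewrite /remainder /= subr0 -/(remainder _ _ _).
  split; rewrite ?sz // ?add0n ?natrD -[n.+1%:R]natr1; lra.
- have [|v [sz inv cT cF]] := IHn (beta * s - 1); first by lra.
  exists (true :: v); rewrite /remainder /= -/(remainder _ _ _).
  split; rewrite ?sz // ?add0n ?natrD -[n.+1%:R]natr1; lra.
Qed.

(** The core [u - 1, u] is centred at h/2. From its left, zeros drive the
    remainder away from 0, and the overshoot stays below beta (u - 1) <= u; from
    its right, ones drive it symmetrically away from h. *)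
Lemma enter_core (R : realType) (beta s : R) :
  let u := (1 + (beta - 1)^-1) / 2 in
  1 < beta < 2 -> 0 < s < (beta - 1)^-1 ->
  exists v : seq bool,
    u - 1 <= remainder beta [seq nat_of_bool c | c <- v] s <= u.
Proof.
move=> u /andP[b1 b2]; set h := (beta - 1)^-1 in u *.
have bh : (beta - 1) * h = 1 by rewrite mulfV // subr_eq0; lra.
have bu : (beta - 1) * u = beta / 2.
  by rewrite /u mulrA mulrDr bh; congr (_ / _); ring.
have bN1 : beta != 1 by apply/eqP; lra.
move=> /andP[s0 sh]; have [s1|s1] := leP s (u - 1).
  have [|n /andP[n1 n2]] := @expanding_orbit R beta s (u - 1) b1; first by rewrite s0.
  exists (nseq n false); rewrite map_nseq remainder_nseq // mul0r subr0 add0r; lra.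
have [s2|s2] := leP u s; last by exists [::]; rewrite /remainder /=; lra.
(* The reflection s -> h - s exchanges the two digits and preserves the core. *)
have [|n /andP[n1 n2]] := @expanding_orbit R beta (h - s) (u - 1) b1.
  by rewrite /u in s2 *; lra.
have hu : h = u + u - 1 by rewrite /u; field.
exists (nseq n true); rewrite map_nseq remainder_nseq // mul1r -/h.
have -> : h + beta ^+ n * (s - h) = h - beta ^+ n * (h - s) by ring.
by move: n1 n2; set z := _ ^+ _ * _ => n1 n2; lra.
Qed.

(** The constant C pays for the transient before the core is reached; what
    matters below is that it does not depend on the length of the word. *)
Lemma balanced_binary (R : realType) (beta s : R) :
  1 < beta < 2 -> 0 < s < (beta - 1)^-1 ->
  exists C : R, forall n, exists v : seq bool,
    [/\ (n <= size v)%N,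
      0 < remainder beta [seq nat_of_bool c | c <- v] s < (beta - 1)^-1,
      (2 - beta) / 2 * (size v)%:R - C <= (count id v)%:R &
      (2 - beta) / 2 * (size v)%:R - C <= (count negb v)%:R].
Proof.
move=> hb hs; have [v0 core] := @enter_core R beta s hb hs.
have /andP[b1 b2] := hb.
have h1 : 1 < (beta - 1)^-1 by rewrite invf_gt1; lra.
exists ((2 - beta) / 2 * (size v0)%:R + 1) => n.
have [v [sz core' cT cF]] := @balanced_from_core R beta n _ hb core.
have p1 := ler0n R (count id v0); have p2 := ler0n R (count negb v0).
exists (v0 ++ v); rewrite map_cat remainder_cat !count_cat size_cat sz !natrD.
split; [exact: leq_addl | lra..].
Qed.

Lemma balanced_pair (R : realType) (beta r : R) (a b : nat) :
  1 < beta < 2 -> (a < b)%N ->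
  a%:R / (beta - 1) < r < b%:R / (beta - 1) ->
  exists C : R, forall n, exists w : seq nat,
    [/\ (n <= size w)%N, all (mem [:: a; b]) w,
      a%:R / (beta - 1) < remainder beta w r < b%:R / (beta - 1),
      (2 - beta) / 2 * (size w)%:R - C <= (count_mem a w)%:R &
      (2 - beta) / 2 * (size w)%:R - C <= (count_mem b w)%:R].
Proof.
move=> hb ltab /andP[ra rb]; have /andP[b1 b2] := hb.
have bN1 : beta != 1 by apply/eqP; lra.
have dpos : 0 < b%:R - a%:R :> R by rewrite subr_gt0 ltr_nat.
set h := (beta - 1)^-1 in ra rb *.
pose s := (r - a%:R * h) / (b%:R - a%:R).
have rE : r = a%:R / (beta - 1) + (b%:R - a%:R) * s.
  by rewrite /s mulrCA divff ?gt_eqF // -/h; ring.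
have hs : 0 < s < (beta - 1)^-1.
  rewrite -/h /s divr_gt0 //=; last by rewrite subr_gt0.
  by rewrite ltr_pdivrMr // mulrBr !(mulrC h) ltrD2r.
have [C HC] := @balanced_binary R beta s hb hs.
exists C => n; have [v [sz /andP[i1 i2] cT cF]] := HC n.
exists [seq if c then b else a | c : bool <- v].
rewrite {1 2}rE remainder_pair // size_map -/h !count_map.
have nab : (b == a) = false by rewrite gtn_eqF.
have -> : count (preim (fun c : bool => if c then b else a) (pred1 a)) v
   = count negb v.
  by apply: eq_count => -[] /=; rewrite ?eqxx ?nab.
have -> : count (preim (fun c : bool => if c then b else a) (pred1 b)) v
   = count id v.
  by apply: eq_count => -[] /=; rewrite ?eqxx // eq_sym nab.
split=> //.
- by apply/allP => d /mapP[[] _ ->]; rewrite !inE eqxx ?orbT.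
- rewrite ltrDl mulr_gt0 //=.
  have : (b%:R - a%:R) * remainder beta [seq nat_of_bool c | c <- v] s
         < (b%:R - a%:R) * h by rewrite ltr_pM2l.
  by rewrite mulrBl; lra.
Qed.

(** * Words that keep the remainder in the interior *)

Definition interior_word (R : realType) (M : nat) (beta x : R) (w : seq nat)
    : bool :=
  all (geq M) w && (0 < remainder beta w x < M%:R / (beta - 1)).

Lemma interior_word_cat (R : realType) (M : nat) (beta x : R) (v w : seq nat) :
  interior_word M beta x v ->
  interior_word M beta (remainder beta v x) w ->
  interior_word M beta x (v ++ w).
Proof.
by move=> /andP[av _] /andP[aw iw]; rewrite /interior_word all_cat av aw remainder_cat.
Qed.

(** The complement of (0, M h) is absorbing: a remainder that is <= 0 or >= M h
    stays so under every digit. Hence it is enough to control the remainder at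
    the end of a word. *)
Lemma interior_word_prefix (R : realType) (M : nat) (beta x : R)
    (v w : seq nat) : 1 < beta ->
  interior_word M beta x (v ++ w) -> interior_word M beta x v.
Proof.
move=> b1; elim/last_ind: w => [|w d IHw]; first by rewrite cats0.
rewrite -rcons_cat => /andP[]; rewrite all_rcons remainder_rcons.
move=> /andP[dM aw] /andP[i1 i2]; apply: IHw; apply/andP; split=> //.
have d0 := ler0n R d; have {}dM : d%:R <= M%:R :> R by rewrite ler_nat.
have b0 : 0 < beta by lra.
have bN : beta - 1 != 0 by rewrite subr_eq0 gt_eqF.
apply/andP; split.
  by rewrite -(pmulr_rgt0 _ b0); lra.
rewrite -(ltr_pM2l b0).
have -> : beta * (M%:R / (beta - 1)) = M%:R / (beta - 1) + M%:R by field.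
lra.
Qed.

Lemma pair_interior (R : realType) (M : nat) (beta r : R) (a b : nat)
    (w : seq nat) : 1 < beta -> (a <= b <= M)%N ->
  all (mem [:: a; b]) w ->
  a%:R / (beta - 1) < remainder beta w r < b%:R / (beta - 1) ->
  interior_word M beta r w.
Proof.
move=> b1 /andP[ab bM] aw /andP[i1 i2]; have h0 : 0 < (beta - 1)^-1.
  by rewrite invr_gt0 subr_gt0.
apply/andP; split.
  apply: sub_all aw => d; rewrite !inE => /orP[]/eqP -> //=.
  exact: leq_trans ab bM.
rewrite (le_lt_trans _ i1) ?mulr_ge0 // ?ltW //= (lt_le_trans i2) //.
by rewrite ler_pM2r // ler_nat.
Qed.

(** For k = 0 a remainder r <= h is pushed above h by zeros; the first passage
    lands at most at beta h < 2 h <= M h. The case k = M is its mirror image.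
    These finitely many occurrences of k do not affect its density. *)
Lemma steer_avoiding (R : realType) (M : nat) (beta r : R) (k : nat) :
  (2 <= M)%N -> 1 < beta < 2 -> 0 < r < M%:R / (beta - 1) ->
  exists a b v, [/\ (a < b <= M)%N, k != a /\ k != b,
    interior_word M beta r v &
    a%:R / (beta - 1) < remainder beta v r < b%:R / (beta - 1)].
Proof.
move=> M2 /andP[b1 b2] hr.
have M_gt0 : (0 < M)%N by rewrite ltnW.
have Mp_gt0 : (0 < M.-1)%N by rewrite -subn1 subn_gt0.
have Mp_lt : (M.-1 < M)%N by rewrite ltn_predL.
have M_neq0 : M != 0%N by rewrite -lt0n.
have /andP[r0 rM] := hr.
have bN1 : beta != 1 by apply/eqP; lra.
set h := (beta - 1)^-1 in rM *.
have h0 : 0 < h by rewrite invr_gt0 subr_gt0.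
have M2R : 2 <= M%:R :> R by rewrite ler_nat.
have bh : beta * h < M%:R * h by rewrite ltr_pM2r //; lra.
have int0 : interior_word M beta r [::] by [].
have [k0|kN0] := eqVneq k 0%N.
  exists 1%N, M; rewrite k0 !mul1r M2 leqnn.
  have kab : (0 != 1 /\ 0 != M)%N by split=> //; rewrite eq_sym.
  have [rh|rh] := ltP h r.
    by exists [::]; split; rewrite ?rh.
  have [|n /andP[n1 n2]] := @expanding_orbit R beta r h b1; first by rewrite r0.
  exists (nseq n 0%N).
  have E : h < remainder beta (nseq n 0%N) r < M%:R * h.
    by rewrite remainder_nseq // mul0r subr0 add0r; lra.
  split; [by [] | exact: kab | | exact: E].
  rewrite /interior_word all_nseq orbT /= -/h.
  by have /andP[E1 ->] := E; rewrite (lt_trans h0 E1).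
have [kM|kNM] := eqVneq k M.
  exists 0%N, M.-1; rewrite mul0r.
  have -> : M.-1%:R = M%:R - 1 :> R by rewrite -subn1 natrB // ltnW.
  rewrite mulrBl mul1r kM Mp_gt0 ltnW //.
  have kab : (M != 0 /\ M != M.-1)%N by split=> //; rewrite [_ == M.-1]gtn_eqF.
  have [rh|rh] := ltP r (M%:R * h - h).
    by exists [::]; split; rewrite ?r0.
  have [|n /andP[n1 n2]] := @expanding_orbit R beta (M%:R * h - r) h b1; first by lra.
  exists (nseq n M).
  have E : 0 < remainder beta (nseq n M) r < M%:R * h - h.
    rewrite remainder_nseq // -/h.
    have -> : M%:R * h + beta ^+ n * (r - M%:R * h)
      = M%:R * h - beta ^+ n * (M%:R * h - r) by ring.
    by move: n1 n2; set z := _ ^+ _ * _ => n1 n2; lra.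
  split; [by [] | exact: kab | | exact: E].
  rewrite /interior_word all_nseq /= leqnn orbT /= -/h.
  by lra.
by exists 0%N, M, [::]; rewrite mul0r M_gt0 leqnn.
Qed.

(** * Making a digit rare or frequent *)

Lemma extend_rare (R : realType) (M : nat) (beta x lo : R) (k m : nat)
    (w : seq nat) :
  (2 <= M)%N -> 1 < beta < 2 -> 0 < lo -> interior_word M beta x w ->
  exists v, [/\ interior_word M beta x (w ++ v), (m <= size (w ++ v))%N &
    (count_mem k (w ++ v))%:R <= lo * (size (w ++ v))%:R].
Proof.
move=> M2 hb lo0 iw; have /andP[_ ri] := iw; have /andP[b1 b2] := hb.
have [a [b [v0 [/andP[ab bM] [ka kb] iv0 pr]]]] :=
  @steer_avoiding R M beta _ k M2 hb ri.
have [C HC] := @balanced_pair R beta _ a b hb ab pr.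
pose c := count_mem k (w ++ v0).
have [N HN] : exists N : nat, c%:R <= lo * N%:R.
  exists (Num.bound (c%:R / lo)); rewrite mulrC -ler_pdivrMr //.
  exact: ltW (archi_boundP (divr_ge0 (ler0n _ _) (ltW lo0))).
have [v1 [+ av1 iv1 _ _]] := HC (maxn m N).
rewrite geq_max => /andP[szm szN].
have k0 : count_mem k v1 = 0%N.
  apply/eqP; rewrite -leqn0 leqNgt -has_count; apply/hasPn => d dv /=.
  apply: contraTneq (allP av1 d dv) => ->.
  by rewrite !inE (negPf ka) (negPf kb).
exists (v0 ++ v1); rewrite catA; split.
- apply: interior_word_cat; first exact: interior_word_cat.
  by rewrite remainder_cat; apply: (pair_interior b1 _ av1 iv1); rewrite ltnW.
- by rewrite size_cat (leq_trans szm) // leq_addl.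
- rewrite count_cat k0 addn0 (le_trans HN) // ler_pM2l // ler_nat size_cat.
  by rewrite (leq_trans szN) // leq_addl.
Qed.

(** The pair is (0, k) or (k, M) according to the side of the fixed point k h on
    which the remainder lies; at the fixed point itself k is repeated. *)
Lemma frequent_words (R : realType) (M : nat) (beta r : R) (k : nat) :
  1 < beta < 2 -> (k <= M)%N -> 0 < r < M%:R / (beta - 1) ->
  exists C : R, forall n, exists w,
    [/\ (n <= size w)%N, interior_word M beta r w &
      (2 - beta) / 2 * (size w)%:R - C <= (count_mem k w)%:R].
Proof.
move=> hb kM ri; have /andP[b1 b2] := hb; have /andP[r0 rM] := ri.
have bN1 : beta != 1 by apply/eqP; lra.
have h0 : 0 < (beta - 1)^-1 by rewrite invr_gt0 subr_gt0.
have [rk|rk|rk] := ltgtP r (k%:R / (beta - 1)).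
- have k0 : (0 < k)%N.
    by rewrite lt0n; apply: contraTneq rk => ->; rewrite mul0r; lra.
  have [|C HC] := @balanced_pair R beta r 0 k hb k0; first by rewrite mul0r r0.
  exists C => n; have [w [sz aw iw _ cb]] := HC n; exists w; split=> //.
  exact: (pair_interior b1 _ aw iw).
- have kM' : (k < M)%N by rewrite -(ltr_nat R) -(ltr_pM2r h0); lra.
  have [|C HC] := @balanced_pair R beta r k M hb kM'; first by rewrite rk.
  exists C => n; have [w [sz aw iw ca _]] := HC n; exists w; split=> //.
  by apply: (pair_interior b1 _ aw iw); rewrite kM leqnn.
- exists 0 => n; exists (nseq n k); split; first by rewrite size_nseq.
    rewrite /interior_word all_nseq /= kM orbT /= remainder_nseq // -rk.
    by rewrite subrr mulr0 addr0.
  rewrite count_nseq size_nseq /= eqxx mul1n subr0.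
  by rewrite ler_piMl ?ler0n //; lra.
Qed.

(** Half of the density (2 - beta)/2 is given up to absorb, in a long enough
    word, both the constant C and the prefix w. *)
Lemma extend_frequent (R : realType) (M : nat) (beta x : R) (k m : nat)
    (w : seq nat) :
  1 < beta < 2 -> (k <= M)%N -> interior_word M beta x w ->
  exists v, [/\ interior_word M beta x (w ++ v), (m <= size (w ++ v))%N &
    (2 - beta) / 4 * (size (w ++ v))%:R <= (count_mem k (w ++ v))%:R].
Proof.
move=> hb kM iw; have /andP[_ ri] := iw; have /andP[b1 b2] := hb.
have [C HC] := @frequent_words R M beta _ k hb kM ri.
pose D := (2 - beta) / 4.
have D0 : 0 < D by rewrite /D; lra.
have [N HN] : exists N : nat, C + D * (size w)%:R <= D * N%:R.
  exists (Num.bound `|(C + D * (size w)%:R) / D|).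
  rewrite [leRHS]mulrC -ler_pdivrMr //; apply: (le_trans (ler_norm _)).
  exact: ltW (archi_boundP (normr_ge0 _)).
have [v [+ iv cv]] := HC (maxn m N).
rewrite geq_max => /andP[szm szN].
have cw := ler0n R (count_mem k w).
have DN : D * N%:R <= D * (size v)%:R by rewrite ler_pM2l // ler_nat.
exists v; split; first exact: interior_word_cat.
  by rewrite size_cat (leq_trans szm) // leq_addl.
rewrite -/D count_cat size_cat !natrD mulrDr.
have e2 : (2 - beta) / 2 * (size v)%:R = D * (size v)%:R + D * (size v)%:R.
  by rewrite /D; field.
lra.
Qed.

(** * The oscillating expansion *)

Lemma limit_of_words (T : Type) (W : nat -> seq T) :
  (forall j, exists v, W j.+1 = W j ++ v) -> (forall j, j <= size (W j))%N ->
  exists a : nat -> T, forall j, mkseq a (size (W j)) = W j.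
Proof.
move=> Wpre Wsz.
have Wmono i j : (i <= j)%N -> exists v, W j = W i ++ v.
  move=> /subnK <-; elim: (j - i)%N => [|n [v IHn]].
    by exists [::]; rewrite cats0.
  have [v' ->] := Wpre (n + i)%N.
  by exists (v ++ v'); rewrite IHn catA.
have [t0 _] : exists t : T, True.
  by case: (W 1%N) (Wsz 1%N) => [|t s] // _; exists t.
exists (fun i => nth t0 (W i.+1) i) => j.
apply: (@eq_from_nth _ t0); rewrite size_mkseq // => i ij.
rewrite nth_mkseq //; have [le|/ltnW le] := leqP i.+1 j.
  by have [v ->] := Wmono _ _ le; rewrite nth_cat Wsz.
by have [v ->] := Wmono _ _ le; rewrite nth_cat ij.
Qed.

(** Stage j deals with the digit j./2 modulo M + 1 and makes it rare or frequent
    according to the parity of j, so every requirement recurs infinitely often. *)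
Lemma oscillating_expansion (R : realType) (M : nat) (beta x lo : R) :
  (2 <= M)%N -> 1 < beta < 2 -> 0 < lo -> 0 < x < M%:R / (beta - 1) ->
  exists b : nat -> nat,
    (forall N, interior_word M beta x (mkseq b N)) /\
    forall k m, (k <= M)%N ->
      (exists2 N, (m <= N)%N & (count_mem k (mkseq b N))%:R <= lo * N%:R) /\
      (exists2 N, (m <= N)%N &
         (2 - beta) / 4 * N%:R <= (count_mem k (mkseq b N))%:R).
Proof.
move=> M2 hb lo0 hx; have /andP[b1 b2] := hb.
pose goal (j : nat) (w : seq nat) : Prop :=
  let c : R := (count_mem (j./2 %% M.+1)%N w)%:R in
  if odd j then c <= lo * (size w)%:R else (2 - beta) / 4 * (size w)%:R <= c.
have step (p : nat * seq nat) : exists v, interior_word M beta x p.2 ->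
    [/\ interior_word M beta x (p.2 ++ v), (p.1 < size (p.2 ++ v))%N &
      goal p.1 (p.2 ++ v)].
  case: p => j w /=; have [iw|] := boolP (interior_word M beta x w); last first.
    by exists [::].
  rewrite /goal; case: (odd j).
    have [v Hv] := @extend_rare R M beta x lo (j./2 %% M.+1) j.+1 w M2 hb lo0 iw.
    by exists v.
  have kM : (j./2 %% M.+1 <= M)%N by rewrite -ltnS ltn_mod.
  have [v Hv] := @extend_frequent R M beta x (j./2 %% M.+1) j.+1 w hb kM iw.
  by exists v.
have [f Hf] := choice step.
pose W := fix W j := if j is i.+1 then W i ++ f (i, W i) else [::].
have Wint j : interior_word M beta x (W j).
  elim: j => [|j IHj]; first exact: hx.
  by have [] := Hf (j, W j) IHj.
have Wgoal j : goal j (W j.+1) by have [] := Hf (j, W j) (Wint j).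
have Wsz j : (j <= size (W j))%N.
  by case: j => // j; have [] := Hf (j, W j) (Wint j).
have [|b Hb] := @limit_of_words nat W _ Wsz.
  by move=> j; exists (f (j, W j)).
exists b; split=> [N|k m kM].
  have := Wint N; rewrite -Hb -(subnKC (Wsz N)) /mkseq iotaD map_cat.
  exact: interior_word_prefix.
(* Stages 2i and 2i + 1 both treat k, at lengths greater than m. *)
pose i := (m * M.+1 + k)%N.
have iM : (i %% M.+1 = k)%N by rewrite /i modnMDl modn_small.
have im : (m <= i)%N by rewrite /i mulnS -addnA leq_addr.
split.
- have := Wgoal (i.*2.+1); rewrite /goal /= odd_double uphalf_double iM => H.
  exists (size (W i.*2.+2)); last by rewrite Hb.
  apply: leq_trans (Wsz _); rewrite -addnn -!addnS.
  by apply: leq_trans im _; rewrite leq_addr.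
- have := Wgoal (i.*2); rewrite /goal odd_double doubleK iM => H.
  exists (size (W i.*2.+1)); last by rewrite Hb.
  apply: leq_trans (Wsz _); rewrite -addnn -!addnS.
  by apply: leq_trans im _; rewrite leq_addr.
Qed.

Lemma sum_digits_remainder (R : realType) (beta x : R) (b : nat -> nat)
    (N : nat) : beta != 0 ->
  \sum_(0 <= i < N) (b i)%:R / beta ^+ i.+1
  = x - remainder beta (mkseq b N) x / beta ^+ N.
Proof.
move=> b0; elim: N => [|N IHN].
  by rewrite big_geq // expr0 divr1 subrr.
rewrite mkseqS big_nat_recr //= IHN remainder_rcons exprS.
have bN : beta ^+ N != 0 by rewrite expf_neq0.
by field; rewrite b0 bN.
Qed.

(** The error of the N-th partial sum is r_N / beta^N, and r_N is bounded. *)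
Lemma interior_digits_expansion (R : realType) (M : nat) (beta x : R)
    (a : nat -> 'I_M.+1) : 1 < beta ->
  (forall N, interior_word M beta x (mkseq (fun i => nat_of_ord (a i)) N)) ->
  beta_expansion beta a x.
Proof.
move=> b1 inta; have b0 : 0 < beta by lra.
have sumE N : series (fun i => (a i)%:R / beta ^+ i.+1 : R) N
    = x - remainder beta (mkseq (fun i => nat_of_ord (a i)) N) x / beta ^+ N.
  by rewrite /series /= (sum_digits_remainder x) ?gt_eqF.
have geo0 : geometric (M%:R / (beta - 1)) beta^-1 @ \oo --> (0 : R).
  by apply: cvg_geometric; rewrite ger0_norm ?invr_ge0 ?invf_lt1 //; lra.
rewrite /beta_expansion.
apply: (@squeeze_cvgr _ _ _ _
  (fun N => x - geometric (M%:R / (beta - 1)) beta^-1 N) (fun=> x)).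
- apply: nearW => N; have /andP[_ /andP[i1 i2]] := inta N.
  have bN : 0 < beta ^- N by rewrite invr_gt0 exprn_gt0.
  rewrite sumE /geometric /= exprVn lerD2l lerN2 ler_pM2r // ltW //=.
  by rewrite gerDl oppr_le0 mulr_ge0 // ltW.
- by rewrite -[X in _ --> X]subr0; apply: cvgB; [exact: cvg_cst|].
- exact: cvg_cst.
Qed.

Lemma digit_countE (M : nat) (a : nat -> 'I_M.+1) (k : 'I_M.+1) (N : nat) :
  digit_count a k N = count_mem (nat_of_ord k) (mkseq (fun i => nat_of_ord (a i)) N).
Proof.
rewrite /digit_count -sum1_card -(big_mkord (fun i => a i == k) (fun=> 1%N)).
by rewrite sum1_count /index_iota subn0 /mkseq count_map; apply: eq_count.
Qed.

Lemma no_freq_of_oscillation (R : realType) (M : nat) (a : nat -> 'I_M.+1)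
    (k : 'I_M.+1) (lo hi : R) : lo < hi ->
  (forall m, exists2 N, (m <= N)%N & (digit_count a k N)%:R <= lo * N%:R) ->
  (forall m, exists2 N, (m <= N)%N & hi * N%:R <= (digit_count a k N)%:R) ->
  ~ exists l : R, has_freq a k l.
Proof.
move=> lohi low high [l /cvgrPdist_lt /(_ ((hi - lo) / 2))].
have e0 : 0 < (hi - lo) / 2 by lra.
move=> /(_ e0) [n _ near_l].
have [N1 le1 c1] := low n.+1; have [N2 le2 c2] := high n.+1.
have N1p : 0 < N1%:R :> R by rewrite ltr0n (leq_trans _ le1).
have N2p : 0 < N2%:R :> R by rewrite ltr0n (leq_trans _ le2).
have := near_l N1 (ltnW le1); have := near_l N2 (ltnW le2) => /=.
move: c1 c2; rewrite -(ler_pdivrMr _ _ N1p) -(ler_pdivlMr _ _ N2p).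
set f1 := _ / N1%:R; set f2 := _ / N2%:R => c1 c2.
by rewrite !ltr_norml => /andP[? ?] /andP[? ?]; lra.
Qed.

Theorem corollary1p5 (R : realType) (M : nat) (hM : (2 <= M)%N)
    (beta : R) (hbeta : 1 < beta < (1 + Num.sqrt 5) / 2)
    (x : R) (hx : 0 < x < M%:R / (beta - 1)) :
  exists a : nat -> 'I_M.+1,
    beta_expansion beta a x /\
    forall k : 'I_M.+1, ~ exists l : R, has_freq a k l.
Proof.
have s5 : Num.sqrt 5 < 3 :> R.
  have -> : 3 = Num.sqrt (3 ^+ 2) :> R by rewrite sqrtr_sqr ger0_norm.
  by rewrite ltr_sqrt; lra.
have hb : 1 < beta < 2 by lra.
have /andP[b1 b2] := hb.
have lo0 : 0 < (2 - beta) / 8 by lra.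
have [b [intb osc]] := @oscillating_expansion R M beta x _ hM hb lo0 hx.
have bM i : (b i < M.+1)%N.
  have /andP[/allP/(_ (b i)) + _] := intb i.+1; apply.
  by apply: map_f; rewrite mem_iota /=.
pose a i : 'I_M.+1 := Ordinal (bM i).
have aE : (fun i => nat_of_ord (a i)) = b by [].
exists a; split.
  by apply: interior_digits_expansion b1 _; rewrite aE.
move=> k; have kM : (k <= M)%N by rewrite -ltnS.
apply: (@no_freq_of_oscillation R M a k ((2 - beta) / 8) ((2 - beta) / 4)).
- by lra.
- by move=> m; have [[N mN cN] _] := osc k m kM; exists N; rewrite // digit_countE aE.
- by move=> m; have [_ [N mN cN]] := osc k m kM; exists N; rewrite // digit_countE aE.
Qed.
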